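(* Let $\lambda\vdash n$ with $\lambda'=(s,r)$, $s\ge r\ge1$, and let $0\le\Delta<r$. Let $\pi$ be a minimal permutation of shape $\lambda$ and let $J$ be a jump partition for $\pi$ of size $\Delta$ that is valid for $\pi$. Then $J(\pi)\in W_\lambda^\Delta$.
   Context: For $\sigma\in S_n$, $\mathrm{inv}(\sigma)$ is its number of inversions and $\mathrm{sh}(\sigma)$ its Robinson–Schensted shape; $\lambda'$ is the conjugate of $\lambda$. $W_\lambda^\Delta$ is the set of permutations of shape $\lambda$ with exactly $\Delta$ more inversions than the minimum over permutations of shape $\lambda$. A minimal permutation of shape $\lambda$ is one attaining this minimum; for $\lambda'=(s,r)$ these are exactly $(c_1,c_1-1,\dots,1,\,n,\dots,c_1+1)$ (one-line notation) with $(c_1,c_2)\in\{(s,r),(r,s)\}$, $n=s+r$. For such $\pi$: $s_t$ is the adjacent transposition $(t\ t{+}1)$; $\sigma\cdot s_t$ swaps the entries at positions $t,t+1$ of $\sigma$, and $s_t\cdot\sigma$ swaps the values $t,t+1$; products act successively (left to right for right multiplication, rightmost first for left multiplication). An inner (resp. outer) jump partition is an integer partition $\mu$ (resp. $\nu$), possibly empty, with $\ell(\mu)\le c_1$, $\mu_1<c_2$ (resp. $\ell(\nu)\le c_1$, $\nu_1<c_2$). Actions: $\pi\circ\mu=\pi\cdot\prod_{j=1}^{\ell(\mu)}(s_{c_1-j+1}s_{c_1-j+2}\cdots s_{c_1-j+\mu_j})$ (factors in order $j=1,2,\dots$ left to right), and $\nu\circ\pi=F_{\ell(\nu)}\cdots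 F_1\cdot\pi$ with $F_j=s_{c_1-j+\nu_j}\cdots s_{c_1-j+2}s_{c_1-j+1}$. A jump partition is a pair $J=(\mu,\nu)$ of size $|\mu|+|\nu|$, with $J(\pi)=\nu\circ(\pi\circ\mu)$; it is valid for $\pi$ if $\mathrm{sh}(J(\pi))=\mathrm{sh}(\pi)$. *)

(* Defs.v *)
From mathcomp Require Import all_boot all_fingroup.

Set Implicit Arguments.
Unset Strict Implicit.
Unset Printing Implicit Defensive.

(* Permutations are 0-based in 'S_n; words, positions and the indices t of the
   adjacent transpositions s_t are 1-based. *)
Definition oneline n (sigma : 'S_n) : seq nat :=
  [seq (val (sigma i)).+1 | i <- enum 'I_n].

Definition inv n (sigma : 'S_n) : nat :=
  #|[set p : 'I_n * 'I_n | (p.1 < p.2) && (sigma p.2 < sigma p.1)]|.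

Definition is_part (la : seq nat) : bool := sorted geq la && (0 \notin la).

Definition part_of (n : nat) (la : seq nat) : bool :=
  is_part la && (sumn la == n).

Definition conj_part (la : seq nat) : seq nat :=
  mkseq (fun j => count (ltn j) la) (head 0 la).

(* The second component is the bumped entry, if any. *)
Fixpoint row_insert (x : nat) (row : seq nat) : seq nat * option nat :=
  match row with
  | [::] => ([:: x], None)
  | y :: row' =>
      if x < y then (x :: row', Some y)
      else let: (row'', b) := row_insert x row' in (y :: row'', b)
  end.

Fixpoint rs_insert (x : nat) (T : seq (seq nat)) : seq (seq nat) :=
  match T with
  | [::] => [:: [:: x]]
  | row :: T' =>
      match row_insert x row with
      | (row', None) => row' :: T'
      | (row', Some y) => row' :: rs_insert y T'
      end
  end.

Definition rs_tableau (w : seq nat) : seq (seq nat) :=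
  foldl (fun T x => rs_insert x T) [::] w.

Definition sh n (sigma : 'S_n) : seq nat := shape (rs_tableau (oneline sigma)).

Definition minimal n (la : seq nat) (pi : 'S_n) : bool :=
  (sh pi == la) && [forall tau : 'S_n, (sh tau == la) ==> (inv pi <= inv tau)].

Definition W n (la : seq nat) (Delta : nat) : {set 'S_n} :=
  [set sigma : 'S_n | (sh sigma == la) &&
     [exists tau : 'S_n, minimal la tau && (inv sigma == inv tau + Delta)]].

(* Identity unless 1 <= t < n. *)
Definition adj n (t : nat) : 'S_n :=
  match insub t.-1, insub t with
  | Some i, Some j => tperm i j
  | _, _ => 1%g
  end.

(* In MathComp, (s * t) x = t (s x), hence the order of the factors. *)
Definition swap_positions n (sigma : 'S_n) (t : nat) : 'S_n :=
  (adj n t * sigma)%g.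

Definition swap_values n (sigma : 'S_n) (t : nat) : 'S_n :=
  (sigma * adj n t)%g.

(* A minimal permutation with two columns is c1 ... 1 n ... c1+1 in one-line
   notation, so c1 is its first entry and c2 = n - c1. *)
Definition c1 n (pi : 'S_n) : nat := head 0 (oneline pi).
Definition c2 n (pi : 'S_n) : nat := n - c1 pi.

(* The indices c-j+1, c-j+2, ..., c-j+mu_j for j = 1, 2, ..., l(mu) in turn,
   where mu_j is nth 0 mu j.-1. *)
Definition jump_word (c : nat) (mu : seq nat) : seq nat :=
  flatten [seq iota (c - j).+1 (nth 0 mu j.-1) | j <- iota 1 (size mu)].

Definition inner_jump n (pi : 'S_n) (mu : seq nat) : 'S_n :=
  foldl (@swap_positions n) pi (jump_word (c1 pi) mu).

(* F_j = s_(c-j+nu_j) ... s_(c-j+1) acts on the left with its rightmost factor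
   first, and F_1 acts before F_2, so the transpositions are again performed in
   the order of jump_word.  The parameter c is the c1 of the minimal permutation,
   not of the permutation sigma acted upon. *)
Definition outer_jump n (c : nat) (nu : seq nat) (sigma : 'S_n) : 'S_n :=
  foldl (@swap_values n) sigma (jump_word c nu).

Definition is_jump_part (a b : nat) (mu : seq nat) : bool :=
  [&& is_part mu, size mu <= a & head 0 mu < b].

(* A jump partition is a pair J = (mu, nu), inner part first. *)
Definition jump_partition n (pi : 'S_n) (J : seq nat * seq nat) : bool :=
  is_jump_part (c1 pi) (c2 pi) J.1 && is_jump_part (c1 pi) (c2 pi) J.2.

Definition jump_size (J : seq nat * seq nat) : nat := sumn J.1 + sumn J.2.

Definition jump n (J : seq nat * seq nat) (pi : 'S_n) : 'S_n :=
  outer_jump (c1 pi) J.2 (inner_jump pi J.1).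

Definition valid_jump n (J : seq nat * seq nat) (pi : 'S_n) : bool :=
  sh (jump J pi) == sh pi.

(* Main.v *)
Require Import Defs.
From mathcomp Require Import all_boot all_fingroup.
From mathcomp Require Import zify.

(** Inserting x into a tableau adds a cell in row k + 1 exactly when k entries are
    bumped, all of them larger than x. Summing over the insertions, a permutation
    of shape la has at least sum_i (i - 1) la_i inversions. If la has two columns,
    equality forces the word to be c ... 1 n ... c+1 for some c: at any other
    insertion some larger entry is not bumped, or a third column appears. The word
    s ... 1 n ... s+1 attains the bound, so minimal permutations have this form.
    The jump J(pi) is u^-1 pi v for permutations u and v whose inversions form the
    diagrams of mu and nu inside the c1 x c2 rectangle of pairs that pi does not
    invert. As |J| < n these two sets of pairs are disjoint, and each pair in their
    union adds one inversion. *)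

Set Implicit Arguments.
Unset Strict Implicit.
Unset Printing Implicit Defensive.

(** * Inversions of a word against the weight of its insertion tableau *)

Definition winv (w : seq nat) : nat :=
  \sum_(0 <= k < size w) \sum_(0 <= i < k) (nth 0 w k < nth 0 w i).

(* The sum of i * (length of row i), with rows numbered from 0. *)
Fixpoint weight (T : seq (seq nat)) : nat :=
  if T is row :: T' then weight T' + size (flatten T') else 0.

Definition greater (x : nat) (T : seq (seq nat)) : nat :=
  count (ltn x) (flatten T).

(* The insertion tableau of the layered word rev u ++ rev v with u ++ v increasing:
   if v is longer than u, its last entries fall into the first column. *)
Fixpoint layered_tab (u v : seq nat) : seq (seq nat) :=
  if u is a :: u' then (a :: take 1 v) :: layered_tab u' (behead v)
  else [seq [:: b] | b <- v].

Lemma count_sum_nth (x : nat) (w : seq nat) :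
  count (ltn x) w = \sum_(0 <= i < size w) (x < nth 0 w i).
Proof.
elim: w => [|y w IH] /=; first by rewrite big_nil.
by rewrite big_nat_recl //= IH.
Qed.

Lemma winv_rcons (w : seq nat) (x : nat) :
  winv (rcons w x) = winv w + count (ltn x) w.
Proof.
(* The outer sum of [winv] runs over the later position, so the new letter contributes exactly the
   last summand. *)
rewrite /winv size_rcons big_nat_recr //=; congr (_ + _).
  rewrite big_nat_cond [RHS]big_nat_cond; apply: eq_bigr => k /andP[/andP[_ hk] _].
  rewrite big_nat_cond [RHS]big_nat_cond; apply: eq_bigr => i /andP[/andP[_ hi] _].
  by rewrite !nth_rcons hk (ltn_trans hi hk).
rewrite count_sum_nth big_nat_cond [RHS]big_nat_cond.
apply: eq_bigr => i /andP[/andP[_ hi] _].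
by rewrite !nth_rcons ltnn eqxx hi.
Qed.

Lemma rs_tableau_rcons (w : seq nat) (x : nat) :
  rs_tableau (rcons w x) = rs_insert x (rs_tableau w).
Proof. by rewrite /rs_tableau -cats1 foldl_cat. Qed.

(** The weight estimates need only the multiset of entries and the fact that the bumped entry
    exceeds [x]; where it stood is forgotten. *)
Variant row_insert_spec (x : nat) (row : seq nat) : seq nat * option nat -> Prop :=
| RowAppend row' of perm_eq row' (x :: row) : row_insert_spec x row (row', None)
| RowBump row' y of x < y & perm_eq (y :: row') (x :: row) :
    row_insert_spec x row (row', Some y).

Lemma row_insertP (x : nat) (row : seq nat) : row_insert_spec x row (row_insert x row).
Proof.
elim: row => [|y row IH] /=; first by constructor.
case: ltnP => hxy.
  by constructor=> //; apply: (permEl (perm_catCA [:: y] [:: x] row)).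
have swap z t : perm_eq (z :: y :: t) (y :: z :: t).
  exact: (permEl (perm_catCA [:: z] [:: y] t)).
case: IH => [row' h | row' z hz h]; constructor=> //.
  by apply: perm_trans (_ : perm_eq _ (y :: x :: row)) _; rewrite ?perm_cons // perm_sym.
apply: perm_trans (swap _ _) _.
by apply: perm_trans (_ : perm_eq _ (y :: x :: row)) _; rewrite ?perm_cons // perm_sym.
Qed.

Lemma perm_rs_insert (x : nat) (T : seq (seq nat)) :
  perm_eq (flatten (rs_insert x T)) (x :: flatten T).
Proof.
elim: T x => [|row T IH] x //=.
case: row_insertP => [row' h | row' y hxy h] /=.
  by rewrite -[x :: row ++ _]/((x :: row) ++ _) perm_cat2r.
apply: (@perm_trans _ (row' ++ (y :: flatten T))); first by rewrite perm_cat2l.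
rewrite -[y :: _]cat1s perm_catCA.
by rewrite -(perm_cat2r (flatten T)) in h.
Qed.

Lemma perm_rs_tableau (w : seq nat) : perm_eq (flatten (rs_tableau w)) w.
Proof.
elim/last_ind: w => [|w x IH] //; rewrite rs_tableau_rcons.
apply: (perm_trans (perm_rs_insert _ _)).
by rewrite perm_sym perm_rcons perm_cons perm_sym.
Qed.

(* The entries bumped on inserting x increase strictly, so there are at most as
   many of them as entries larger than x. *)
Lemma weight_rs_insert (x : nat) (T : seq (seq nat)) :
  weight (rs_insert x T) <= weight T + greater x T.
Proof.
elim: T x => [|row T IH] x //=.
rewrite /greater /= count_cat; case: row_insertP => [row' h | row' y hxy h] /=; first by lia.
have /seq.permP/(_ (ltn x)) /= := h; rewrite ltnn hxy => hcount.
have := perm_size (perm_rs_insert y T) => /= ->.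
have := IH y; rewrite /greater.
have : count (ltn y) (flatten T) <= count (ltn x) (flatten T).
  by apply: sub_count => z /= /(ltn_trans hxy).
lia.
Qed.

Lemma greater_rs_tableau (x : nat) (w : seq nat) :
  greater x (rs_tableau w) = count (ltn x) w.
Proof. exact/seq.permP/perm_rs_tableau. Qed.

Lemma weight_le_winv (w : seq nat) : weight (rs_tableau w) <= winv w.
Proof.
elim/last_ind: w => [|w x IH]; first by rewrite /winv big_nil.
rewrite rs_tableau_rcons winv_rcons.
apply: (leq_trans (weight_rs_insert _ _)).
rewrite greater_rs_tableau.
by rewrite leq_add2r.
Qed.

(** Equality in a sum of two inequalities forces equality in both, so the equality case passes to
    prefixes. *)
Lemma weight_eq_rcons (w : seq nat) (x : nat) :
  weight (rs_tableau (rcons w x)) = winv (rcons w x) ->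
  weight (rs_tableau w) = winv w /\
  weight (rs_insert x (rs_tableau w)) = weight (rs_tableau w) + count (ltn x) w.
Proof.
rewrite rs_tableau_rcons winv_rcons.
have := weight_rs_insert x (rs_tableau w); have := weight_le_winv w.
rewrite greater_rs_tableau.
lia.
Qed.

Lemma weight_shape (T1 T2 : seq (seq nat)) : shape T1 = shape T2 -> weight T1 = weight T2.
Proof.
elim: T1 T2 => [|r1 T1 IH] [|r2 T2] //= [_ h].
by rewrite (IH _ h) !size_flatten h.
Qed.

Lemma size_row_insert (x : nat) (row : seq nat) :
  size row <= size (row_insert x row).1.
Proof.
elim: row => [|y row IH] //=; case: ifP => // _.
by case: (row_insert x row) IH.
Qed.

(** The first row never shrinks, so a bound on the number of columns passes to prefixes as well. *)
Lemma head_shape_insert (x : nat) (T : seq (seq nat)) :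
  head 0 (shape T) <= head 0 (shape (rs_insert x T)).
Proof.
case: T => [|row T] //=; have := size_row_insert x row.
by case: (row_insert x row) => row' [y|].
Qed.

(** * Insertion of layered words *)

Lemma insert_column (x : nat) (v : seq nat) : path ltn x v ->
  rs_insert x [seq [:: b] | b <- v] = [seq [:: b] | b <- x :: v].
Proof.
by elim: v x => [|b v IH] x //= /andP[-> /IH ->].
Qed.

Lemma insert_first (x : nat) (u : seq nat) : path ltn x u ->
  rs_insert x (layered_tab u [::]) = layered_tab (x :: u) [::].
Proof.
by elim: u x => [|b v IH] x //= /andP[-> /IH ->].
Qed.

(** In the first row [x] passes the head of [u] and bumps the head of [v]; that entry meets the same
    situation one row below, so [v] moves down by one cell. *)
Lemma insert_second (x : nat) (u v : seq nat) : sorted ltn u -> path ltn x v ->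
  head 0 u < x -> (forall a b, a \in u -> b \in v -> a < b) ->
  rs_insert x (layered_tab u v) = layered_tab u (x :: v).
Proof.
elim: u x v => [|a u IH] x v su pv hx huv; first exact: insert_column.
rewrite /=; case: v pv huv => [|b v] /=; first by rewrite ltnNge (ltnW hx).
case/andP=> hxb pv huv.
rewrite ltnNge (ltnW hx) /= hxb /= take0.
rewrite IH ?(path_sorted su) //.
(* When [u] is exhausted its head defaults to 0, and [0 < b] follows from [x < b]. *)
- by case: u {IH su hx} huv => [|a' u] huv /=; [lia | apply: huv; rewrite !inE eqxx ?orbT].
- by move=> c d hc hd; apply: huv; rewrite inE ?hc ?hd orbT.
Qed.

Lemma size_flatten_tab (u v : seq nat) :
  size (flatten (layered_tab u v)) = size u + size v.
Proof.
elim: u v => [|a u IH] v /=; first by elim: v => //= b v ->.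
by rewrite size_cat IH size_behead /=; case: v => //= b v; rewrite take0 /=; lia.
Qed.

Lemma weight_tab_first (x : nat) (u : seq nat) :
  weight (layered_tab (x :: u) [::]) = weight (layered_tab u [::]) + size u.
Proof. by rewrite /= size_flatten_tab addn0. Qed.

Lemma weight_tab_second (x : nat) (u v : seq nat) :
  weight (layered_tab u (x :: v)) = weight (layered_tab u v) + size v.
Proof.
elim: u x v => [|a u IH] x v /=.
  by rewrite (size_flatten_tab [::]).
case: v => [|b v] /=; rewrite ?IH !size_flatten_tab /= ?addn0 //; lia.
Qed.

Lemma size_tab (u v : seq nat) : size (layered_tab u v) = maxn (size u) (size v).
Proof.
elim: u v => [|a u IH] v /=; first by rewrite size_map max0n.
by rewrite IH size_behead; lia.
Qed.

Lemma rev_cat_cons (u v : seq nat) (x : nat) :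
  rev u ++ rev (x :: v) = rcons (rev u ++ rev v) x.
Proof. by rewrite rev_cons rcons_cat. Qed.

Lemma ltn_sorted_cat (u v : seq nat) : sorted ltn (u ++ v) ->
  [/\ sorted ltn u, sorted ltn v & forall a b, a \in u -> b \in v -> a < b].
Proof.
rewrite !(sorted_pairwise ltn_trans) pairwise_cat => /and3P[/allrelP h -> ->].
by split=> // a b ha hb; apply: h.
Qed.

Lemma ltn_path (x : nat) (v : seq nat) :
  path ltn x v = all (ltn x) v && sorted ltn v.
Proof. exact: path_sortedE ltn_trans x v. Qed.

Lemma count_ltn_all (x : nat) (v : seq nat) : all (ltn x) v -> count (ltn x) v = size v.
Proof. by rewrite all_count => /eqP. Qed.

(** Each letter bumps exactly the entries larger than it, namely the earlier letters of its own
    block. The last condition makes a decreasing word have only a first block. *)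
Lemma rs_layered (u v : seq nat) : sorted ltn (u ++ v) -> (u == [::]) ==> (v == [::]) ->
  rs_tableau (rev u ++ rev v) = layered_tab u v /\
  winv (rev u ++ rev v) = weight (layered_tab u v).
Proof.
elim: v => [|x v IH] suv huv.
  rewrite !cats0 in suv *.
  elim: u suv {huv} => [|x u IH] su; first by rewrite /winv big_nil.
  have [h1 h2] := IH (path_sorted su).
  rewrite rev_cons rs_tableau_rcons winv_rcons h1 h2 insert_first // weight_tab_first.
  move: su; rewrite /= ltn_path => /andP[/count_ltn_all su _].
  by rewrite count_rev su.
have [su sv hlt] := ltn_sorted_cat suv.
have u0 : u != [::] by case: (u) huv.
have suv' : sorted ltn (u ++ v).
  apply: (subseq_sorted ltn_trans _ suv).
  by rewrite cat_subseq // subseq_cons.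
have [h1 h2] := IH suv' ltac:(by rewrite (negbTE u0)).
rewrite rev_cat_cons rs_tableau_rcons winv_rcons h1 h2.
rewrite insert_second //; last 2 first.
- case: (u) u0 hlt => [|a u'] //= _ hlt; apply: hlt; exact: mem_head.
- by move=> a b ha hb; apply: hlt; rewrite // inE hb orbT.
rewrite weight_tab_second count_cat !count_rev.
move: sv; rewrite /= ltn_path => /andP[/count_ltn_all -> _].
rewrite (@eq_in_count _ (ltn x) pred0) ?count_pred0 //.
by move=> a ha /=; have := hlt a x ha (mem_head _ _); lia.
Qed.

(** The weight grows by the index of the row receiving the new cell, which is at most the number of
    rows. *)
Lemma weight_rs_insert_rows (x : nat) (T : seq (seq nat)) :
  weight (rs_insert x T) <= weight T + size T.
Proof.
elim: T x => [|row T IH] x //=.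
case: row_insertP => [row' h | row' y hxy h] /=; first by lia.
have := perm_size (perm_rs_insert y T) => /= ->.
have := IH y; lia.
Qed.

Lemma layered_of_weight (w : seq nat) :
  uniq w -> head 0 (shape (rs_tableau w)) <= 2 ->
  weight (rs_tableau w) = winv w ->
  exists u v, [/\ w = rev u ++ rev v, sorted ltn (u ++ v) & (u == [::]) ==> (v == [::])].
Proof.
elim/last_ind: w => [|w x IH]; first by exists [::], [::].
rewrite rcons_uniq => /andP[xw uw] hsh /weight_eq_rcons[hw].
have hsh' : head 0 (shape (rs_tableau w)) <= 2.
  by apply: leq_trans hsh; rewrite rs_tableau_rcons head_shape_insert.
have [u [v [Ew suv uv0]]] := IH uw hsh' hw.
move: xw hsh; rewrite rs_tableau_rcons {}Ew (rs_layered suv uv0).1 {IH uw hsh' hw w}.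
rewrite mem_cat !mem_rev negb_or count_cat !count_rev => /andP[xu xv] hsh E.
case: u suv uv0 xu hsh E => [|a u] suv uv0 xu hsh E.
  have -> : v = [::] by case: (v) uv0.
  by exists [:: x], [::].
have [su sv hlt] := ltn_sorted_cat suv.
(* If [x] is below the first block, it must extend that block, and [v] must be empty: otherwise
   [size u + size v + 1] entries exceed [x], while the tableau has fewer rows than that. *)
have [hxa|hax] := ltnP x a.
  have pxu : path ltn x (a :: u) by rewrite /= hxa; exact: su.
  case: v xv suv uv0 hsh E sv hlt => [|b v] xv suv uv0 hsh E sv hlt.
    exists (x :: a :: u), [::]; rewrite !cats0; split=> //.
    by rewrite [RHS]rev_cons.
  exfalso; have := weight_rs_insert_rows x (layered_tab (a :: u) (b :: v)).
  rewrite {}E size_tab count_ltn_all; last by move: pxu; rewrite ltn_path => /andP[].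
  rewrite count_ltn_all /=; first by lia.
  have hab := hlt a b (mem_head _ _) (mem_head _ _).
  have hxb := ltn_trans hxa hab.
  rewrite hxb; move: sv; rewrite /= ltn_path => /andP[/allP hv _].
  by apply/allP => z /hv /=; apply: ltn_trans.
have {}hax : a < x by move: xu; rewrite inE negb_or => /andP[? _]; lia.
(* An [x] beyond the head of [v] would be appended to a first row of length two and open a third
   column. *)
have hpx : path ltn x v.
  case: v xv hsh {E uv0 suv hlt} sv => [|b v] //= xv hsh ->; rewrite andbT.
  have [//|hbx] := ltnP x b.
  by move: hsh; rewrite take0 /= ltnNge (ltnW hax) /= ltnNge hbx.
rewrite insert_second // weight_tab_second in E.
have hv : count (ltn x) v = size v by move: hpx; rewrite ltn_path => /andP[/count_ltn_all].
(* The entries of [v] already account for the whole gain in weight, so no entry of the first block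
   may exceed [x]. *)
have hu : count (ltn x) (a :: u) = 0 by lia.
exists (a :: u), (x :: v); split=> //; first by rewrite rev_cat_cons.
rewrite (sorted_pairwise ltn_trans) pairwise_cat -!(sorted_pairwise ltn_trans) su /= hpx andbT.
apply/allrelP => c d hc; rewrite inE => /orP[/eqP->|]; last exact: hlt.
have : ~~ has (ltn x) (a :: u) by rewrite has_count hu.
move/hasPn/(_ c hc) => /=; rewrite -leqNgt leq_eqVlt => /orP[/eqP Ec|//].
by move: xu; rewrite -Ec hc.
Qed.

(** * Partitions with two columns *)

Lemma two_column_partition (la : seq nat) :
  sorted geq la -> all (fun x => 0 < x <= 2) la ->
  la = nseq (count (ltn 1) la) 2 ++ nseq (count (ltn 0) la - count (ltn 1) la) 1.
Proof.
elim: la => [|x la IH] //= hp /andP[hx hall].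
have E := IH (path_sorted hp) hall.
have h0 : count (ltn 0) la = size la.
  by apply: count_ltn_all; apply: sub_all hall => z /andP[].
have := count_size (ltn 1) la.
case: x hx hp => [|[|[|x]]] //= _ hp hc; last by rewrite {1}E add1n; congr (_ :: (_ ++ nseq _ _)); lia.
(* Here the leading part is 1, so no later part exceeds 1. *)
have h1 : count (ltn 1) la = 0.
  apply/eqP; rewrite -leqn0 leqNgt -has_count; apply/hasPn => z hz.
  have /allP/(_ z hz) := order_path_min (rev_trans leq_trans) hp.
  by rewrite /=; lia.
by rewrite {1}E h1 !subn0.
Qed.

Lemma shape_layered_tab (u v : seq nat) : size v <= size u ->
  shape (layered_tab u v) = nseq (size v) 2 ++ nseq (size u - size v) 1.
Proof.
elim: u v => [|a u IH] [|b v] //= h; last by rewrite take0 IH.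
by rewrite IH //= subn0.
Qed.

Lemma shape_of_conj (n : nat) (la : seq nat) (s r : nat) :
  part_of n la -> conj_part la = [:: s; r] ->
  n = s + r /\ la = nseq r 2 ++ nseq (s - r) 1.
Proof.
case/andP=> /andP[hs h0] /eqP <- hc.
have hh : head 0 la = 2 by have := congr1 size hc; rewrite size_mkseq.
move: hc; rewrite /conj_part hh /= => -[E0 E1].
have hall : all (fun x => 0 < x <= 2) la.
  apply/allP => z hz; apply/andP; split.
    by rewrite lt0n; apply: contraNneq h0 => <-.
  case: la hs hh {h0 E0 E1} hz => [|y la] //= hp Ey; rewrite inE -Ey => /orP[/eqP->//|hz].
  by have /allP/(_ z hz) := order_path_min (rev_trans leq_trans) hp.
have E := two_column_partition hs hall.
rewrite E0 E1 in E; split=> //.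
rewrite E sumn_cat !sumn_nseq.
have : r <= s by rewrite -E0 -E1; apply: sub_count => z /=; apply: ltn_trans.
lia.
Qed.

(** * Permutations and their one-line words *)

Lemma size_oneline (n : nat) (sigma : 'S_n) : size (oneline sigma) = n.
Proof. by rewrite size_map size_enum_ord. Qed.

Lemma nth_oneline (n : nat) (sigma : 'S_n) (i : 'I_n) :
  nth 0 (oneline sigma) i = (sigma i).+1.
Proof. by rewrite (nth_map i) ?size_enum_ord // nth_ord_enum. Qed.

Lemma inv_sum (n : nat) (sigma : 'S_n) :
  Defs.inv sigma = \sum_(i < n) \sum_(k < n) ((i < k) && (sigma k < sigma i)).
Proof.
rewrite /Defs.inv -sum1dep_card pair_big /= big_mkcond /=.
by apply: eq_bigr => -[i k] _ /=; case: ifP.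
Qed.

Lemma inv_winv (n : nat) (sigma : 'S_n) : Defs.inv sigma = winv (oneline sigma).
Proof.
rewrite inv_sum exchange_big /winv size_oneline big_mkord; apply: eq_bigr => k _ /=.
rewrite (big_nat_widen _ _ n) ?(ltnW (ltn_ord k)) //= big_mkord [RHS]big_mkcond /=.
by apply: eq_bigr => i _; rewrite !nth_oneline ltnS; case: (i < k).
Qed.

Lemma perm_oneline (n : nat) (sigma : 'S_n) : perm_eq (oneline sigma) (iota 1 n).
Proof.
have uo : uniq (oneline sigma).
  by rewrite map_inj_uniq ?enum_uniq // => i k [] /val_inj /perm_inj.
have [] := uniq_min_size uo (_ : {subset _ <= iota 1 n}) _.
- move=> z /mapP[i _ ->]; rewrite mem_iota add1n ltnS /=; exact: ltn_ord.
- by rewrite size_oneline size_iota.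
- by move=> _ h; apply: uniq_perm => //; exact: iota_uniq.
Qed.

Lemma perm_of_word (n : nat) (w : seq nat) :
  perm_eq w (iota 1 n) -> exists tau : 'S_n, oneline tau = w.
Proof.
move=> hw; have sw : size w = n by rewrite (perm_size hw) size_iota.
have bound (i : 'I_n) : 0 < nth 0 w i <= n.
  have := mem_nth 0 (_ : i < size w); rewrite sw ltn_ord => /(_ isT).
  by rewrite (perm_mem hw) mem_iota add1n ltnS.
have lt_n (i : 'I_n) : (nth 0 w i).-1 < n by have := bound i; lia.
have inj_f : injective (fun i => Ordinal (lt_n i)).
  move=> i k [] E.
  have Enth : nth 0 w i = nth 0 w k by have := bound i; have := bound k; lia.
  apply/val_inj/eqP => /=.
  rewrite -(nth_uniq 0 _ _ (_ : uniq w)) ?sw ?ltn_ord //; last first.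
    by rewrite (perm_uniq hw) iota_uniq.
  by apply/eqP; exact: Enth.
exists (perm inj_f); apply: (@eq_from_nth _ 0); rewrite size_oneline ?sw // => i hi.
rewrite (nth_oneline _ (Ordinal hi)) permE /= prednK //.
by have /andP[] := bound (Ordinal hi).
Qed.

(** * The form of minimal permutations *)

Lemma minimal_layered (n : nat) (la : seq nat) (s r : nat) (pi : 'S_n) :
  part_of n la -> conj_part la = [:: s; r] -> r <= s -> minimal la pi ->
  exists2 c, c <= n & oneline pi = rev (iota 1 c) ++ rev (iota c.+1 (n - c)).
Proof.
move=> hla hc hrs /andP[/eqP hsh /forallP hmin].
have [En Ela] := shape_of_conj hla hc.
have sorted_uv : sorted ltn (iota 1 s ++ iota s.+1 r).
  by rewrite -[s.+1]/(1 + s) -iotaD iota_ltn_sorted.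
have [] := rs_layered sorted_uv.
  by apply/implyP; rewrite -!size_eq0 !size_iota; lia.
set w := rev _ ++ rev _ => hT hw.
(* This competitor has shape [la] and as many inversions as the weight of that shape, so the minimal
   [pi] attains the lower bound too. *)
have [tau Etau] : exists tau : 'S_n, oneline tau = w.
  apply: perm_of_word; rewrite En iotaD perm_cat //.
  - by rewrite perm_rev.
  - by rewrite perm_rev.
have sh_tau : sh tau = la.
  by rewrite /sh Etau hT shape_layered_tab !size_iota.
have := hmin tau; rewrite sh_tau eqxx /= !inv_winv Etau hw => le_w.
have eq_w : weight (rs_tableau (oneline pi)) = winv (oneline pi).
  apply/eqP; rewrite eqn_leq weight_le_winv /=.
  rewrite (@weight_shape _ (layered_tab (iota 1 s) (iota s.+1 r))) //.
  by rewrite -hT -Etau -/(sh tau) sh_tau -hsh.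
have hp := perm_oneline pi.
have [] := layered_of_weight _ _ eq_w.
- by rewrite (perm_uniq hp) iota_uniq.
- by rewrite -/(sh pi) hsh Ela; case: (r) => [|?] //=; case: (s - _).
move=> u [v [Euv suv _]].
(* An increasing arrangement of the letters 1, ..., n is unique, so the two blocks are intervals. *)
have Eiota : u ++ v = iota 1 n.
  apply: (irr_sorted_eq ltn_trans ltnn suv (iota_ltn_sorted 1 n)).
  by move=> z; rewrite -(perm_mem hp) Euv !mem_cat !mem_rev.
have sz : size u <= n by rewrite -(size_iota 1 n) -Eiota size_cat leq_addr.
exists (size u) => //; rewrite Euv.
move/eqP: Eiota; rewrite -{1}(subnKC sz) iotaD eqseq_cat ?size_iota // add1n.
by case/andP=> /eqP <- /eqP <-.
Qed.

Lemma layered_val (n c : nat) (pi : 'S_n) (i : 'I_n) : c <= n ->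
  oneline pi = rev (iota 1 c) ++ rev (iota c.+1 (n - c)) ->
  pi i = (if i < c then c - i.+1 else n - (i - c).+1) :> nat.
Proof.
move=> hc E; apply: succn_inj; rewrite -nth_oneline E nth_cat size_rev size_iota.
have hi := ltn_ord i.
case: ltnP => h; rewrite nth_rev ?size_iota ?nth_iota; lia.
Qed.

Lemma c1_layered (n c : nat) (pi : 'S_n) : 0 < c ->
  oneline pi = rev (iota 1 c) ++ rev (iota c.+1 (n - c)) -> c1 pi = c.
Proof.
move=> hc E; rewrite /c1 E -nth0 nth_cat size_rev size_iota hc.
by rewrite nth_rev ?size_iota ?nth_iota; lia.
Qed.

(** * The permutation performed by a jump *)

(* The letter at position c - j, for j >= 1, crosses mu_j later ones; the one at
   position c + m is crossed by the mu'_(m+1) rows of mu longer than m. *)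
Definition jump_pos (c : nat) (mu : seq nat) (i : nat) : nat :=
  if i < c then i + nth 0 mu (c - i.+1) else i - count (ltn (i - c)) mu.

(** One product serves both actions: the outer jump multiplies by it on the right, the inner jump by
    its inverse on the left. *)
Definition jump_perm (n c : nat) (mu : seq nat) : 'S_n :=
  foldl (fun sigma t => sigma * adj n t)%g 1%g (jump_word c mu).

Lemma jump_word_rcons (c : nat) (mu : seq nat) (a : nat) : size mu < c ->
  jump_word c (rcons mu a) = jump_word c mu ++ iota (c - size mu) a.
Proof.
move=> hc; rewrite /jump_word size_rcons -[(size mu).+1]addn1 iotaD map_cat flatten_cat /= cats0.
congr (flatten _ ++ iota _ _); last 2 first.
- by lia.
- by rewrite nth_rcons ltnn eqxx.
apply/eq_in_map => j; rewrite mem_iota => hj.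
by rewrite nth_rcons (_ : j.-1 < size mu) //; lia.
Qed.

Lemma adj_val (n t : nat) (x : 'I_n) : 0 < t < n ->
  adj n t x = (if x == t.-1 :> nat then t else if x == t :> nat then t.-1 else x) :> nat.
Proof.
case/andP=> t0 tn; rewrite /adj.
have tn' : t.-1 < n by lia.
rewrite (insubT (fun i => i < n) tn) (insubT (fun i => i < n) tn') /=.
case: tpermP => [->|->|h1 h2] /=; first by rewrite eqxx.
  by rewrite eqxx; case: eqP; lia.
by do 2![case: eqP => [E|_]; first by [case: h1; apply: val_inj | case: h2; apply: val_inj]].
Qed.

(** Induction on the rows of [mu], the shortest row [a] coming last, and within that row on the
    number [k] of transpositions performed. *)
Lemma jump_perm_val (n c : nat) (mu : seq nat) (i : 'I_n) :
  is_jump_part c (n - c) mu -> jump_perm n c mu i = jump_pos c mu i :> nat.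
Proof.
elim/last_ind: mu i => [|mu a IH] i.
  by move=> _; rewrite perm1 /jump_pos nth_nil /= addn0 subn0; case: ifP.
case/and3P=> /andP[hs h0]; rewrite size_rcons => hc hhead.
have all_a m : m \in mu -> a <= m.
  move: hs; rewrite (sorted_pairwise (rev_trans leq_trans)) pairwise_rcons.
  by case/andP=> /allP h _ /h.
have hmu : is_jump_part c (n - c) mu.
  rewrite /is_jump_part /is_part (ltnW hc).
  move: h0; rewrite mem_rcons inE negb_or => /andP[_ ->].
  move: hs; rewrite -cats1 => /cat_sorted2[-> _] /=.
  by case: (mu) hhead => //=; lia.
have ha : a < n - c.
  case: (mu) all_a hhead => [|m mu'] //= all_a.
  by apply: leq_ltn_trans; apply: all_a; apply: mem_head.
rewrite /jump_perm jump_word_rcons // foldl_cat -/(jump_perm n c mu).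
suff step k (x : 'I_n) : k <= a ->
    foldl (fun sigma t => sigma * adj n t)%g (jump_perm n c mu) (iota (c - size mu) k) x
    = jump_pos c (rcons mu k) x :> nat by apply: step.
elim: k x => [|k IHk] x hk.
  (* A trailing row of length 0 does not change [jump_pos]. *)
  rewrite /= IH // /jump_pos -cats1 count_cat /= !addn0; case: ifP => // _.
  by rewrite nth_cat; case: ltnP => // h; rewrite (nth_default _ h); case: (_ - size mu) => [|[|?]].
rewrite -[k.+1]addn1 iotaD foldl_cat /=.
set u := foldl _ _ _ in IHk *.
have {}IHk y := IHk y (ltnW hk).
have cnt m : m <= k -> count (ltn m) mu = size mu.
  by move=> hm; apply: count_ltn_all; apply/allP => z /all_a /=; lia.
have hn : c + k < n by lia.
have hn' : c - (size mu).+1 < n by lia.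
(* [small] is the letter moved by the last row, and [big] the one it crosses next. All earlier rows
   are longer than [k], so [big] has been shifted by [size mu] and is now right after [small]. *)
pose small := Ordinal hn'; pose big := Ordinal hn.
have pos_small m : jump_pos c (rcons mu m) small = c - (size mu).+1 + m.
  rewrite /jump_pos /= (_ : _ < c); last by lia.
  have -> : c - (c - (size mu).+1).+1 = size mu by lia.
  by rewrite nth_rcons ltnn eqxx.
have pos_big m : jump_pos c (rcons mu m) big = c + k - (size mu + (k < m)).
  rewrite /jump_pos /= ltnNge leq_addr /= addKn -cats1 count_cat cnt //=.
  by rewrite addn0.
rewrite permM adj_val; last by lia.
case: eqP => [E|/eqP ne1].
  have -> : x = small by apply/(@perm_inj _ u)/val_inj; rewrite /= E IHk pos_small; lia.
  by rewrite pos_small; lia.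
case: eqP => [E|/eqP ne2].
  have -> : x = big by apply/(@perm_inj _ u)/val_inj; rewrite /= E IHk pos_big ltnn; lia.
  by rewrite pos_big; lia.
have x1 : x <> c - (size mu).+1 :> nat.
  move=> Ex; case/eqP: ne1; have -> : x = small by apply: val_inj.
  by rewrite IHk pos_small; lia.
have x2 : x <> c + k :> nat.
  move=> Ex; case/eqP: ne2; have -> : x = big by apply: val_inj.
  by rewrite IHk pos_big ltnn; lia.
rewrite IHk /jump_pos; case: ltnP => hx.
  by rewrite !nth_rcons (_ : (c - x.+1 == size mu) = false) //; apply: negbTE; apply/eqP; lia.
by rewrite -!cats1 !count_cat /= (_ : (x - c < k) = (x - c < k + 1)) //; lia.
Qed.

Lemma foldl_swap_values (n : nat) (sigma : 'S_n) (w : seq nat) :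
  foldl (@swap_values n) sigma w =
  (sigma * foldl (fun tau t => tau * adj n t) 1 w)%g.
Proof.
elim/last_ind: w => [|w t IH]; first by rewrite /= mulg1.
by rewrite !foldl_rcons IH mulgA.
Qed.

Lemma adjV (n t : nat) : ((adj n t)^-1)%g = adj n t.
Proof.
by rewrite /adj; case: insub => [i|]; rewrite ?invg1 //; case: insub => [k|]; rewrite ?tpermV ?invg1.
Qed.

Lemma foldl_swap_positions (n : nat) (sigma : 'S_n) (w : seq nat) :
  foldl (@swap_positions n) sigma w =
  ((foldl (fun tau t => tau * adj n t) 1 w)^-1 * sigma)%g.
Proof.
elim/last_ind: w => [|w t IH]; first by rewrite /= invg1 mul1g.
by rewrite !foldl_rcons IH invMg adjV /swap_positions mulgA.
Qed.

(** * Inversions of a jump as cells of a diagram *)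

(** Both sides say that the cell in row [j] and column [m], counted from 0, lies in the diagram of
    [mu]. *)
Lemma ltn_nth_count (mu : seq nat) (j m : nat) : sorted geq mu ->
  (m < nth 0 mu j) = (j < count (ltn m) mu).
Proof.
elim: mu j => [|a mu IH] j hs; first by rewrite nth_nil.
have {}IH l := IH l (path_sorted hs).
have hmu : a <= m -> count (ltn m) mu = 0.
  move=> ham; apply/eqP; rewrite -leqn0 leqNgt -has_count; apply/hasPn => z hz.
  have /allP/(_ z hz) := order_path_min (rev_trans leq_trans) hs.
  by rewrite /= -leqNgt => hza; apply: leq_trans hza ham.
by case: j => [|j] /=; rewrite ?IH; case: (ltnP m a) => h; rewrite ?(hmu h).
Qed.

Lemma leq_nth_nth (mu : seq nat) (i j : nat) : sorted geq mu -> i <= j ->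
  nth 0 mu j <= nth 0 mu i.
Proof.
move=> hs hij; rewrite leqNgt ltn_nth_count //.
by have := ltn_nth_count i (nth 0 mu i) hs; rewrite ltnn; lia.
Qed.

(** The first [m.+1] cells of the rows longer than [m] form a rectangle inside the diagram. *)
Lemma count_sumn (mu : seq nat) (m : nat) : count (ltn m) mu * m.+1 <= sumn mu.
Proof.
elim: mu => [|a mu IH] //=; rewrite mulnDl leq_add //.
by case: ltnP => /= h; rewrite ?mul1n.
Qed.

(** The pair [(i, k)] across the cut at [c] stands for the cell in row [c - i.+1] and column
    [k - c]. *)
Definition jump_inv (c : nat) (mu : seq nat) (i k : nat) : bool :=
  (i < c <= k) && (k - c < nth 0 mu (c - i.+1)).

Lemma jump_pos_inv (c b : nat) (mu : seq nat) (i k : nat) :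
  is_jump_part c b mu -> i < k ->
  (jump_pos c mu k < jump_pos c mu i) = jump_inv c mu i k.
Proof.
case/and3P=> /andP[hs _] hc _ hik; rewrite /jump_pos /jump_inv.
have hcount m := leq_trans (count_size (ltn m) mu) hc.
have [hi|hi] /= := ltnP i c; have [hk|hk] /= := ltnP k c; try lia.
- by have /(leq_nth_nth hs) : c - k.+1 <= c - i.+1; lia.
(* The value [i + k - c] separates the cases: in the diagram [i + A] exceeds it and [k - B] does
   not; outside, the reverse holds. *)
- have := ltn_nth_count (c - i.+1) (k - c) hs; have := hcount (k - c).
  set A := nth _ _ _; set B := count _ _; lia.
- have : count (ltn (k - c)) mu <= count (ltn (i - c)) mu.
    by apply: sub_count => z /=; lia.
  by have := hcount (i - c); lia.
Qed.

Lemma sum_ltn (N a : nat) : \sum_(0 <= k < N) (k < a) = minn a N.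
Proof.
elim: N => [|N IH]; first by rewrite big_geq ?minn0.
by rewrite big_nat_recr //= IH; case: ltnP; lia.
Qed.

Lemma sumn_sum_nth (mu : seq nat) (c : nat) : size mu <= c ->
  \sum_(0 <= i < c) nth 0 mu i = sumn mu.
Proof.
elim: mu c => [|a mu IH] c hc; first by rewrite big1 // => i _; rewrite nth_nil.
by case: c hc => // c hc; rewrite big_nat_recl //= IH.
Qed.

Lemma sum_jump_inv (n c : nat) (mu : seq nat) : c <= n -> is_jump_part c (n - c) mu ->
  \sum_(i < n) \sum_(k < n) jump_inv c mu i k = sumn mu.
Proof.
move=> hcn /and3P[/andP[hs _] hc hhead].
rewrite -(big_mkord xpredT (fun i => \sum_(k < n) jump_inv c mu i k)).
rewrite (@big_cat_nat _ _ _ c) //= [X in _ + X]big_nat_cond [X in _ + X]big1 ?addn0; last first.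
  move=> i /andP[/andP[hi _] _]; rewrite big1 // => k _.
  by rewrite /jump_inv ltnNge hi.
rewrite -(sumn_sum_nth hc) [RHS]big_nat_rev add0n big_nat_cond [RHS]big_nat_cond.
apply: eq_bigr => i /andP[/andP[_ hi] _].
rewrite -(big_mkord xpredT (fun k => nat_of_bool (jump_inv c mu i k))).
rewrite (@big_cat_nat _ _ _ c) //= big_nat_cond big1 ?add0n; last first.
  by move=> k /andP[/andP[_ hk] _]; rewrite /jump_inv [c <= k]leqNgt hk andbF.
rewrite -[X in \sum_(X <= _ < _) _]add0n big_addn.
have := leq_nth_nth hs (leq0n (c - i.+1)); rewrite nth0 => hle.
under eq_bigr => k _ do rewrite /jump_inv hi leq_addl /= addnK.
(* The row is not truncated, since its length is below [n - c]. *)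
by rewrite sum_ltn; lia.
Qed.

(** * Counting the inversions of the jumped permutation *)

(** Reindexing by a permutation may reverse a pair, so the two counts agree only on unordered
    pairs. *)
Lemma eq_sum_sym (I : finType) (f g : I -> I -> nat) :
  (forall i k, f i k + f k i = g i k + g k i) ->
  \sum_i \sum_k f i k = \sum_i \sum_k g i k.
Proof.
move=> h; apply: double_inj; rewrite -!addnn.
have sym F : \sum_i \sum_k F i k + \sum_i \sum_k F i k
           = \sum_(i : I) \sum_(k : I) (F i k + F k i) :> nat.
  rewrite {2}exchange_big -big_split; apply: eq_bigr => i _.
  by rewrite -big_split.
by rewrite !sym; do 2![apply: eq_bigr => ? _].
Qed.

(* With a = c - i, a' = i + 1, b = k - c + 1 and b' = n - k, a common pair forces
   J to have at least ab + a'b' >= (a + b - 1) + (a' + b' - 1) = n boxes. *)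
Lemma jump_inv_disjoint (n c : nat) (mu nu : seq nat) (i k : nat) : k < n ->
  sorted geq mu -> sorted geq nu -> sumn mu + sumn nu < n ->
  jump_inv c mu i k ->
  ~~ jump_inv c nu (c - i.+1) (n - (k - c).+1).
Proof.
move=> hk hmu hnu hsum /andP[/andP[hi hck] h1]; apply/negP => /andP[_ h2].
move: h1 h2; rewrite !ltn_nth_count // => h1 h2.
have := count_sumn mu (k - c); have := count_sumn nu (n - (k - c).+1 - c).
nia.
Qed.

Lemma inv_jump (n c : nat) (pi : 'S_n) (mu nu : seq nat) : c <= n ->
  oneline pi = rev (iota 1 c) ++ rev (iota c.+1 (n - c)) ->
  is_jump_part c (n - c) mu -> is_jump_part c (n - c) nu ->
  sumn mu + sumn nu < n ->
  Defs.inv ((jump_perm n c mu)^-1 * pi * jump_perm n c nu)%g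
  = Defs.inv pi + (sumn mu + sumn nu).
Proof.
move=> hcn hpi hmu hnu hsum; set u := jump_perm n c mu; set v := jump_perm n c nu.
have pi_val i := layered_val i hcn hpi.
rewrite !inv_sum (reindex_inj (@perm_inj _ u)) /=.
under eq_bigr => i _ do rewrite (reindex_inj (@perm_inj _ u)) /=.
under eq_bigr => i _ do under eq_bigr => k _ do rewrite !permM !permK.
rewrite -(sum_jump_inv hcn hmu) -(sum_jump_inv hcn hnu).
(* The cells of [nu] are indexed by values; transport along [pi] indexes them by positions, like
   those of [mu]. *)
rewrite [X in _ = _ + (_ + X)](reindex_inj (@perm_inj _ pi)) /=.
under [X in _ = _ + (_ + X)]eq_bigr => i _ do rewrite (reindex_inj (@perm_inj _ pi)) /=.
rewrite -!big_split /=.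
under [RHS]eq_bigr => i _ do rewrite -!big_split /=.
apply: eq_sum_sym => i k.
wlog hik : i k / i < k.
  move=> H; have : [|| i < k, k < i | val i == val k] by case: ltngtP.
  case/or3P=> [h|h|/eqP/val_inj ->]; first exact: H h.
    by rewrite addnC (H _ _ h) addnC.
  by rewrite !ltnn /= /jump_inv; lia.
have hsmu : sorted geq mu by case/and3P: hmu => /andP[].
have hsnu : sorted geq nu by case/and3P: hnu => /andP[].
have hk := ltn_ord k.
have hu : (u k < u i) = jump_inv c mu i k.
  by rewrite !jump_perm_val // (jump_pos_inv hmu).
have nu_ik : u i != u k :> nat.
  by apply: contraTneq hik => /val_inj /perm_inj ->; rewrite ltnn.
have nv_ik : v (pi i) != v (pi k) :> nat.
  by apply: contraTneq hik => /val_inj /perm_inj /perm_inj ->; rewrite ltnn.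
have side j : (pi j < c) = (j < c).
  by rewrite pi_val; have hj := ltn_ord j; case: (ltnP j c); lia.
have hki : jump_inv c mu k i = false by rewrite /jump_inv; lia.
have hki' : jump_inv c nu (pi k) (pi i) = false.
  by rewrite /jump_inv side (leqNgt c (pi i)) side; lia.
rewrite hki hki' -hu (ltnNge k i) (ltnW hik) hik /=.
(* A pair across the cut is not inverted by [pi]; it becomes inverted when exactly one of [u] and
   [v] reverses it, and by disjointness never both do. *)
have [/andP[hi hck]|hcross] := boolP (i < c <= k).
  have lt_pi : pi i < pi k by rewrite !pi_val hi (ltnNge k c) hck /=; lia.
  have hv : (v (pi k) < v (pi i)) = jump_inv c nu (pi i) (pi k).
    by rewrite !jump_perm_val // (jump_pos_inv hnu).
  have hdis : u k < u i -> ~~ (v (pi k) < v (pi i)).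
    rewrite hu hv !pi_val hi (ltnNge k c) hck /=; exact: jump_inv_disjoint.
  by rewrite -hv; lia.
(* A pair within one block is inverted by [pi], and neither [u] nor [v] reverses it. *)
have lt_pi : pi k < pi i.
  by rewrite !pi_val; move: hcross; case: (ltnP i c); case: (ltnP k c); lia.
have hv : (v (pi i) < v (pi k)) = false.
  by rewrite !jump_perm_val // (jump_pos_inv hnu).
have h1 : jump_inv c mu i k = false by rewrite /jump_inv (negbTE hcross).
have h2 : jump_inv c nu (pi i) (pi k) = false.
  by rewrite /jump_inv side (leqNgt c (pi k)) side -leqNgt (negbTE hcross).
by move: h1; rewrite -hu h2 lt_pi; lia.
Qed.

Theorem theorem19 (n : nat) (la : seq nat) (s r Delta : nat) (pi : 'S_n)
    (J : seq nat * seq nat)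
    (hla : part_of n la) (hconj : conj_part la = [:: s; r])
    (hsr : r <= s) (hr : 1 <= r) (hDelta : Delta < r)
    (hpi : minimal la pi)
    (hJ : jump_partition pi J) (hsize : jump_size J = Delta)
    (hvalid : valid_jump J pi) :
  jump J pi \in W n la Delta.
Proof.
have [c hcn Epi] := minimal_layered hla hconj hsr hpi.
have [En _] := shape_of_conj hla hconj.
have Ec : c1 pi = c.
  (* For [c = 0] the word is decreasing, so [c1 pi] is [n] and [c2 pi] is 0, which leaves no jump
     partition at all. *)
  have [c0|] := posnP c; last by move=> c0; apply: c1_layered c0 Epi.
  case/andP: hJ => /and3P[_ _]; rewrite /c2.
  suff -> : c1 pi = n by rewrite subnn.
  by rewrite /c1 Epi c0 /= subn0 -nth0 nth_rev size_iota ?nth_iota; lia.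
case/andP: hJ; rewrite /c2 Ec => hmu hnu.
rewrite inE; have /andP[/eqP hsh _] := hpi.
rewrite -{1}hsh; apply/andP; split; first exact: hvalid.
apply/existsP; exists pi; rewrite hpi /= -hsize.
rewrite /jump /outer_jump foldl_swap_values /inner_jump foldl_swap_positions Ec.
rewrite (inv_jump hcn Epi hmu hnu) //.
(* The size of [J] is below [r], hence below [n = s + r], as disjointness requires. *)
by move: hDelta; rewrite -hsize /jump_size; lia.
Qed.
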